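(* For all integers $n\geq 3$ except $n=5$, $6$, and $8$, the hyperoctahedral group $B_n$ is a quotient of the triangle group $T(2,4,6)=\langle x,y,z \mid x^2=y^4=z^6=xyz=1\rangle$. In the exceptional cases, $B_5$, $B_6$ and $B_8$ are quotients of the triangle groups $T(2,4,10)$, $T(2,6,6)$, and $T(2,4,8)$ respectively.
   Context: For $n\geq 3$, the hyperoctahedral group $B_n$ is the group of symmetries of the $n$-dimensional cube (the finite Coxeter group of type $B_n$); equivalently, it is the group of all $n\times n$ signed permutation matrices, or the wreath product $\mathbb{Z}_2\wr \Sigma_n$, where $\Sigma_n$ is the symmetric group on $n$ letters. It has order $n!\,2^n$. For positive integers $p,q,r$, the triangle group is $T(p,q,r)=\langle x,y,z \mid x^p=y^q=z^r=xyz=1\rangle$. A group $G$ is a quotient of $T$ if there is a surjective homomorphism $T\to G$. *)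

(* Defs.v *)
From HB Require Import structures.
From mathcomp Require Import all_boot all_order all_algebra all_fingroup.
From mathcomp Require Import generic_quotient boolp.

Set Implicit Arguments.
Unset Strict Implicit.
Unset Printing Implicit Defensive.

Import GRing.Theory Num.Theory.

Local Open Scope quotient_scope.
Local Open Scope group_scope.

(* A letter (i, false) stands for the generator i, and (i, true) for its
   formal inverse. *)
Definition word (I : Type) : Type := seq (I * bool).

Definition word_inv (I : Type) (w : word I) : word I :=
  rev [seq (a.1, ~~ a.2) | a <- w].

(* The least congruence on words that cancels adjacent inverse letters and
   kills the relators: its classes form the group < I | rels >. *)
Inductive word_eq (I : eqType) (rels : seq (word I)) :
    word I -> word I -> Prop :=
| word_eq_refl u : word_eq rels u u
| word_eq_sym u v : word_eq rels u v -> word_eq rels v u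
| word_eq_trans u v w :
    word_eq rels u v -> word_eq rels v w -> word_eq rels u w
| word_eq_cat u u' v v' :
    word_eq rels u u' -> word_eq rels v v' -> word_eq rels (u ++ v) (u' ++ v')
| word_eq_cancel i b : word_eq rels [:: (i, b); (i, ~~ b)] [::]
| word_eq_relator r : r \in rels -> word_eq rels r [::].

Lemma word_eq_mulV (I : eqType) (rels : seq (word I)) (w : word I) :
  word_eq rels (w ++ word_inv w) [::].
Proof.
elim: w => [|[i b] w IHw]; first exact: word_eq_refl.
rewrite /word_inv map_cons rev_cons -cats1 catA -cat1s /= -cat_cons.
apply: word_eq_trans (word_eq_cancel rels i b).
rewrite -[X in word_eq _ _ X]/([:: (i, b)] ++ [::] ++ [:: (i, ~~ b)]).
rewrite -cat1s -catA; apply: word_eq_cat; first exact: word_eq_refl.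
by apply: word_eq_cat; [exact: IHw | exact: word_eq_refl].
Qed.

Lemma word_invK (I : Type) : involutive (@word_inv I).
Proof.
move=> w; rewrite /word_inv map_rev revK -map_comp -[RHS]map_id.
by apply: eq_map => -[i b] /=; rewrite negbK.
Qed.

Lemma word_eq_inv (I : eqType) (rels : seq (word I)) (u v : word I) :
  word_eq rels u v -> word_eq rels (word_inv u) (word_inv v).
Proof.
move=> uv; have vu := word_eq_sym uv.
have e1 : word_eq rels (word_inv u) (word_inv u ++ (v ++ word_inv v)).
  rewrite -[X in word_eq _ X]cats0; apply: word_eq_cat.
    exact: word_eq_refl.
  exact/word_eq_sym/word_eq_mulV.
apply: word_eq_trans e1 _; rewrite catA -[X in word_eq _ _ X]cat0s.
apply: word_eq_cat; last exact: word_eq_refl.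
apply: (@word_eq_trans _ _ _ (word_inv u ++ u)).
  by apply: word_eq_cat => //; exact: word_eq_refl.
by rewrite -{2}[u]word_invK; exact: word_eq_mulV.
Qed.

Section PresentedGroup.

Variables (I : choiceType) (rels : seq (word I)).

Definition word_eqb : rel (word I) := fun u v => `[< word_eq rels u v >].

Lemma word_eqb_equiv : equiv_class_of word_eqb.
Proof.
split=> [u|u v|v u w].
- exact/asboolP/word_eq_refl.
- by apply/asboolP/asboolP; exact: word_eq_sym.
- by move=> /asboolP uv /asboolP vw; apply/asboolP/(word_eq_trans uv vw).
Qed.

Canonical word_equiv := EquivRelPack word_eqb_equiv.

Definition presented : Type := {eq_quot word_equiv}.

HB.instance Definition _ := Choice.on presented.

Definition class_of (w : word I) : presented := \pi_({eq_quot word_equiv}) w.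

Definition word_of (g : presented) : word I := repr g.

Lemma word_ofK : cancel word_of class_of.
Proof. by move=> g; rewrite /class_of /word_of reprK. Qed.

Lemma class_ofP (u v : word I) : class_of u = class_of v <-> word_eq rels u v.
Proof.
by split=> [/eqmodP/asboolP //|uv]; apply/eqmodP/asboolP.
Qed.

Lemma class_of_eq (w : word I) : word_eq rels (word_of (class_of w)) w.
Proof. by apply/class_ofP; rewrite word_ofK. Qed.

Definition presented_mul (g h : presented) : presented :=
  class_of (word_of g ++ word_of h).

Definition presented_inv (g : presented) : presented :=
  class_of (word_inv (word_of g)).

Lemma presented_mulE (u v : word I) :
  presented_mul (class_of u) (class_of v) = class_of (u ++ v).
Proof. by apply/class_ofP/word_eq_cat; exact: class_of_eq. Qed.

Lemma presented_invE (u : word I) :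
  presented_inv (class_of u) = class_of (word_inv u).
Proof. by apply/class_ofP/word_eq_inv; exact: class_of_eq. Qed.

Lemma presented_mulA : associative presented_mul.
Proof.
move=> a b c; rewrite -[a]word_ofK -[b]word_ofK -[c]word_ofK.
by rewrite !presented_mulE catA.
Qed.

Lemma presented_mul1 : left_id (class_of [::]) presented_mul.
Proof. by move=> a; rewrite -[a]word_ofK presented_mulE. Qed.

Lemma presented_mulr1 : right_id (class_of [::]) presented_mul.
Proof. by move=> a; rewrite -[a]word_ofK presented_mulE cats0. Qed.

Lemma presented_mulV :
  left_inverse (class_of [::]) presented_inv presented_mul.
Proof.
move=> a; rewrite -[a]word_ofK presented_invE presented_mulE.
apply/class_ofP; rewrite -{2}[word_of a]word_invK; exact: word_eq_mulV.
Qed.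

Lemma presented_mulrV :
  right_inverse (class_of [::]) presented_inv presented_mul.
Proof.
move=> a; rewrite -[a]word_ofK presented_invE presented_mulE.
by apply/class_ofP; exact: word_eq_mulV.
Qed.

HB.instance Definition _ := isGroup.Build presented
  presented_mulA presented_mul1 presented_mulr1 presented_mulV presented_mulrV.

End PresentedGroup.

(* The generators x, y, z are the elements 0, 1, 2 of 'I_3. *)
Definition triangle_relators (p q r : nat) : seq (word 'I_3) :=
  let x : 'I_3 * bool := (inord 0, false) in
  let y : 'I_3 * bool := (inord 1, false) in
  let z : 'I_3 * bool := (inord 2, false) in
  [:: nseq p x; nseq q y; nseq r z; [:: x; y; z]].

Definition triangle_group (p q r : nat) : groupType :=
  presented (triangle_relators p q r).

(* The integer matrices whose entrywise absolute value is a permutation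
   matrix. *)
Definition is_signed_perm_mx (n : nat) (A : 'M[int]_n) : bool :=
  is_perm_mx (map_mx (fun a : int => `|a|%R) A).

Section SignedPerm.

Local Open Scope ring_scope.

Variable n : nat.
Implicit Types A B : 'M[int]_n.

Lemma normz_eq1 (a : int) : `|a| = 1 -> a = (-1) ^+ (a < 0)%R.
Proof. by move=> a1; rewrite [LHS]realEsign ?num_real // a1 mulr1. Qed.

Lemma signed_permP A :
  reflect (exists (s : 'S_n) (e : {ffun 'I_n -> bool}),
             A = \matrix_(i, j) ((-1) ^+ e i *+ (s i == j)))
          (is_signed_perm_mx A).
Proof.
apply: (iffP (is_perm_mxP _)) => [[s /matrixP As]|[s [e ->]]]; exists s.
  exists [ffun i => (A i (s i) < 0)%R]; apply/matrixP=> i j; rewrite !mxE ffunE.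
  have := As i j; rewrite !mxE; case: eqP => [<-|_] /=.
    by move=> /normz_eq1 {1}->.
  by move/eqP; rewrite normr_eq0 => /eqP.
apply/matrixP=> i j; rewrite !mxE.
by case: eqP => _; rewrite ?mulr0n ?normr0 // mulr1n normrX normrN1 expr1n.
Qed.

Lemma signed_perm1 : is_signed_perm_mx (1%:M : 'M[int]_n).
Proof.
apply/signed_permP; exists 1%g, [ffun=> false].
by apply/matrixP=> i j; rewrite !mxE perm1 ffunE.
Qed.

Lemma signed_permM A B :
  is_signed_perm_mx A -> is_signed_perm_mx B -> is_signed_perm_mx (A *m B).
Proof.
move=> /signed_permP[s [e ->]] /signed_permP[t [f ->]]; apply/signed_permP.
exists (s * t)%g, [ffun i => e i (+) f (s i)]; apply/matrixP=> i j.
rewrite !mxE (bigD1 (s i)) //= big1 => [|k ki].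
  by rewrite !mxE eqxx mulr1n addr0 permM ffunE signr_addb mulrnAr.
by rewrite !mxE eq_sym (negPf ki) mulr0n mul0r.
Qed.

Lemma signed_permV A : is_signed_perm_mx A -> is_signed_perm_mx A^T.
Proof.
move=> /signed_permP[s [e ->]]; apply/signed_permP.
exists s^-1%g, [ffun i => e (s^-1%g i)]; apply/matrixP=> i j.
rewrite !mxE ffunE -(inj_eq (@perm_inj _ s) _ j) permKV eq_sym.
by case: eqP => [->|//]; rewrite permK.
Qed.

Lemma signed_perm_mulmxV A : is_signed_perm_mx A -> A *m A^T = 1%:M.
Proof.
move=> /signed_permP[s [e ->]]; apply/matrixP=> i j.
rewrite !mxE (bigD1 (s i)) //= big1 => [|k ki].
  rewrite !mxE eqxx mulr1n addr0 (inj_eq perm_inj) eq_sym.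
  by case: eqP => [->|_]; rewrite ?mulr0n ?mulr0 // mulr1n -signr_addb addbb.
by rewrite !mxE eq_sym (negPf ki) mulr0n mul0r.
Qed.

Lemma signed_perm_mulVmx A : is_signed_perm_mx A -> A^T *m A = 1%:M.
Proof. by move=> /signed_permV/signed_perm_mulmxV; rewrite trmxK. Qed.

Definition hyperoctahedral : Type := {A : 'M[int]_n | is_signed_perm_mx A}.

HB.instance Definition _ := Choice.on hyperoctahedral.

Definition hyp_one : hyperoctahedral := exist _ 1%:M signed_perm1.

Definition hyp_mul (a b : hyperoctahedral) : hyperoctahedral :=
  exist _ (sval a *m sval b) (signed_permM (svalP a) (svalP b)).

Definition hyp_inv (a : hyperoctahedral) : hyperoctahedral :=
  exist _ (sval a)^T (signed_permV (svalP a)).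

Lemma hyp_mulA : associative hyp_mul.
Proof. by move=> a b c; apply: val_inj; rewrite /= mulmxA. Qed.

Lemma hyp_mul1 : left_id hyp_one hyp_mul.
Proof. by move=> a; apply: val_inj; rewrite /= mul1mx. Qed.

Lemma hyp_mulr1 : right_id hyp_one hyp_mul.
Proof. by move=> a; apply: val_inj; rewrite /= mulmx1. Qed.

Lemma hyp_mulV : left_inverse hyp_one hyp_inv hyp_mul.
Proof. by move=> a; apply: val_inj; exact: signed_perm_mulVmx (svalP a). Qed.

Lemma hyp_mulrV : right_inverse hyp_one hyp_inv hyp_mul.
Proof. by move=> a; apply: val_inj; exact: signed_perm_mulmxV (svalP a). Qed.

HB.instance Definition _ := isGroup.Build hyperoctahedral
  hyp_mulA hyp_mul1 hyp_mulr1 hyp_mulV hyp_mulrV.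

End SignedPerm.

Definition is_quotient_of (G T : groupType) : Prop :=
  exists f : {multiplicative T -> G}, forall g : G, exists t : T, f t = g.

(* Main.v *)
From HB Require Import structures.
Require Import Defs.
From mathcomp Require Import all_boot all_order all_algebra all_fingroup.
From mathcomp Require Import boolp zify.

(** A homomorphism from [T(2,q,r)] to a group is a pair [X, Y] with
    [X^2 = Y^q = (XY)^r = 1], so the task is to write down, for each [n], such a
    pair of signed permutations and to show that it generates [B_n].

    Generation is reduced to a few facts about single words in [X] and [Y].  Let
    [K] be the subgroup that [X] and [Y] generate.
    - Suppose that a word acts, up to signs, as a 3-cycle on [a, b, c], that
      [X a] and [Y a] lie in [{a, b, c}], and that the action on points is
      transitive.  Lying in a common 3-cycle is a [K]-invariant equivalence
      relation ([linked_trans]), so it has a single class, and the permutations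
      underlying [K] contain all 3-cycles ([all_cyc3]), hence all even
      permutations ([even_perm_in]).  The fourth power of a signed 3-cycle is over
      the same 3-cycle and has an even number of signs, so each even permutation
      has a lift in [K] with evenly many signs.
    - Suppose that a word fixes all points and changes the signs of some of them
      but not of all.  Multiplied by a conjugate under a lift of a 3-cycle, it
      changes exactly two signs ([pair_flip_exists]); so [K] contains all changes
      of evenly many signs.
    - These two facts put into [K] the kernel of the homomorphism from [B_n] to
      [Z/2 x Z/2] given by the sign of the permutation and the parity of the number
      of signs.  Two words with independent images finish ([full_of_classes]).
    The result is [quotient_criterion].

    For large [n] the pair is read off a planar coset diagram that is a chain: a
    head, [m] copies of a block of 6 points, and a tail.  Every block has ports: fixed
    points of [X] in a 3-cycle of [XY].  Letting [X] swap two ports merges their two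
    3-cycles into a 6-cycle, so the relations survive.  All signs sit in the head.
    The words of the certificates move the points only boundedly far along the
    chain, with orbits of bounded length.  So a suitable power of one of them fixes all
    points outside the head and is a 3-cycle there, and a suitable power of another
    fixes all points; its signs at two chosen points of the head do not
    depend on [m].  The address of a point records the numbers of blocks on its left and
    on its right, in unary: a word that stays within five blocks can then be
    evaluated symbolically, for all [m] at once.

    Six heads, one for each residue of [n] modulo 6, treat all [n >= 19] except 20;
    the remaining [n] use a diagram with a single block. *)

Set Implicit Arguments.
Unset Strict Implicit.
Unset Printing Implicit Defensive.

Import GRing.Theory Num.Theory.

(** * Signed permutations as pairs *)

Section SignedPermutations.

Local Open Scope group_scope.

(** The pair [(s, e)] stands for the matrix whose row [i] has its nonzero entry
    [(-1) ^+ e i] in column [s i]. *)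
Definition sperm (n : nat) : predArgType := ('S_n * {ffun 'I_n -> bool})%type.

HB.instance Definition _ n := Finite.on (sperm n).

Section SpermGroup.

Variable n : nat.
Implicit Types a b c : sperm n.

Definition sperm_one : sperm n := (1, [ffun=> false]).
Definition sperm_mul a b : sperm n := (a.1 * b.1, [ffun i => a.2 i (+) b.2 (a.1 i)]).
Definition sperm_inv a : sperm n := (a.1^-1, [ffun i => a.2 (a.1^-1 i)]).

Lemma sperm_eqP a b : a.1 = b.1 -> a.2 =1 b.2 -> a = b.
Proof. by case: a b => [s e] [t f] /= -> /ffunP ->. Qed.

Lemma sperm_mulA : associative sperm_mul.
Proof.
move=> a b c; apply: sperm_eqP => [|i] /=; first exact: mulgA.
by rewrite !ffunE permM addbA.
Qed.

Lemma sperm_mul1 : left_id sperm_one sperm_mul.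
Proof.
move=> a; apply: sperm_eqP => [|i] /=; first exact: mul1g.
by rewrite !ffunE perm1.
Qed.

Lemma sperm_mulV : left_inverse sperm_one sperm_inv sperm_mul.
Proof.
move=> a; apply: sperm_eqP => [|i] /=; first exact: mulVg.
by rewrite !ffunE addbb.
Qed.

HB.instance Definition _ := Finite_isGroup.Build (sperm n)
  sperm_mulA sperm_mul1 sperm_mulV.

Lemma sperm1E (i : 'I_n) : (1 : sperm n).2 i = false.
Proof. by rewrite ffunE. Qed.

Lemma spermM1 a b : (a * b).1 = a.1 * b.1. Proof. by []. Qed.

Lemma spermM2 a b i : (a * b).2 i = a.2 i (+) b.2 (a.1 i).
Proof. by rewrite ffunE. Qed.

Lemma spermX1 a k : (a ^+ k).1 = a.1 ^+ k.
Proof. by elim: k => // k IHk; rewrite !expgS -IHk. Qed.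

Definition neg_parity a : bool := \big[addb/false]_i a.2 i.

Lemma neg_parityM a b : neg_parity (a * b) = neg_parity a (+) neg_parity b.
Proof.
rewrite /neg_parity (eq_bigr (fun i => a.2 i (+) b.2 (a.1 i))); last first.
  by move=> i _; rewrite spermM2.
by rewrite big_split /=; congr (_ (+) _); rewrite [RHS](reindex_inj (@perm_inj _ a.1)).
Qed.

Lemma neg_parity1 : neg_parity 1 = false.
Proof. by rewrite /neg_parity big1 // => i _; rewrite sperm1E. Qed.

Lemma neg_parityV a : neg_parity a^-1 = neg_parity a.
Proof.
by apply: (@addIb (neg_parity a)); rewrite -neg_parityM mulVg neg_parity1 addbb.
Qed.

Definition sperm_mx a : 'M[int]_n :=
  (\matrix_(i, j) ((-1) ^+ a.2 i *+ (a.1 i == j)))%R.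

Lemma sperm_mxP a : is_signed_perm_mx (sperm_mx a).
Proof. by apply/signed_permP; exists a.1, a.2. Qed.

Definition to_hyp a : hyperoctahedral n := exist _ (sperm_mx a) (sperm_mxP a).

Lemma to_hypM : {morph to_hyp : a b / a * b}.
Proof.
move=> a b; apply: val_inj; apply/matrixP=> i j /=.
rewrite !mxE (bigD1 (a.1 i)) //= big1 ?addr0 => [|k ki].
  by rewrite !mxE eqxx mulr1n permM ffunE signr_addb mulrnAr.
by rewrite !mxE eq_sym (negPf ki) mulr0n mul0r.
Qed.

Lemma to_hyp1 : to_hyp 1 = 1.
Proof. by apply: (mulgI (to_hyp 1)); rewrite -to_hypM !mulg1. Qed.

Lemma to_hyp_surj (g : hyperoctahedral n) : exists a, to_hyp a = g.
Proof.
have /signed_permP[s [e ge]] := svalP g.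
by exists (s, e); apply: val_inj.
Qed.

End SpermGroup.

End SignedPermutations.

(** * Three-cycles *)

Section ThreeCycles.

Local Open Scope group_scope.

Variable T : finType.
Implicit Types (a b c d : T) (s t : {perm T}).

Definition cyc3 a b c : {perm T} := tperm a b * tperm a c.

Lemma cyc3J a b c s : cyc3 a b c ^ s = cyc3 (s a) (s b) (s c).
Proof. by rewrite conjMg !tpermJ. Qed.

Lemma cyc3V a b c : (cyc3 a b c)^-1 = cyc3 a c b.
Proof. by rewrite invMg !tpermV. Qed.

Lemma odd_cyc3 a b c : a != b -> a != c -> odd_perm (cyc3 a b c) = false.
Proof. by move=> ab ac; rewrite odd_permM !odd_tperm ab ac. Qed.

Section Distinct.
Variables a b c : T.
Hypotheses (ab : a != b) (ac : a != c) (bc : b != c).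

Lemma cyc3E1 : cyc3 a b c a = b.
Proof. by rewrite permM tpermL tpermD // eq_sym. Qed.

Lemma cyc3E2 : cyc3 a b c b = c.
Proof. by rewrite permM tpermR tpermL. Qed.

Lemma cyc3E3 : cyc3 a b c c = a.
Proof. by rewrite permM (@tpermD _ a b) // tpermR. Qed.

Lemma cyc3D i : i != a -> i != b -> i != c -> cyc3 a b c i = i.
Proof. by move=> ia ib ic; rewrite permM !tpermD // eq_sym. Qed.

Lemma cyc3_eq s : s a = b -> s b = c -> s c = a ->
  (forall i, i != a -> i != b -> i != c -> s i = i) -> s = cyc3 a b c.
Proof.
move=> sa sb sc sD; apply/permP=> i.
have [->|ia] := eqVneq i a; first by rewrite cyc3E1.
have [->|ib] := eqVneq i b; first by rewrite cyc3E2.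
have [->|ic] := eqVneq i c; first by rewrite cyc3E3.
by rewrite sD // cyc3D.
Qed.

Lemma cyc3X3 : cyc3 a b c ^+ 3 = 1.
Proof.
have X3 (t : {perm T}) i : (t ^+ 3) i = t (t (t i)) by rewrite !expgS expg0 mulg1 !permM.
apply/permP=> i; rewrite perm1 X3.
have [->|ia] := eqVneq i a; first by rewrite cyc3E1 cyc3E2 cyc3E3.
have [->|ib] := eqVneq i b; first by rewrite cyc3E2 cyc3E3 cyc3E1.
have [->|ic] := eqVneq i c; first by rewrite cyc3E3 cyc3E1 cyc3E2.
by rewrite !cyc3D.
Qed.

End Distinct.

Lemma cyc3_rot a b c : a != b -> a != c -> b != c -> cyc3 a b c = cyc3 b c a.
Proof.
move=> ab ac bc; apply/esym/cyc3_eq => //; rewrite ?cyc3E1 ?cyc3E2 ?cyc3E3 // 1?eq_sym //.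
by move=> i ia ib ic; rewrite cyc3D.
Qed.

Section Linked.

Variable H : {group {perm T}}.

Definition linked a b :=
  (a == b) || [exists c, [&& a != b, a != c, b != c & cyc3 a b c \in H]].

Lemma linked_cyc3 a b c :
  a != b -> a != c -> b != c -> cyc3 a b c \in H -> linked a b.
Proof. by move=> ? ? ? ?; apply/orP; right; apply/existsP; exists c; apply/and4P. Qed.

Lemma linkedxx a : linked a a.
Proof. by rewrite /linked eqxx. Qed.

Lemma linked_sym a b : linked a b -> linked b a.
Proof.
case/orP=> [/eqP->|/existsP[c /and4P[ab ac bc h]]]; first exact: linkedxx.
have ba : b != a by rewrite eq_sym.
by apply: (linked_cyc3 ba bc ac); rewrite -groupV cyc3V -cyc3_rot.
Qed.

(** If [b] and [d] lie in a 3-cycle [t] and the 3-cycle [s] through [a] and [b]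
    misses [d], then the conjugate of [t] by [s] or by its inverse moves [b] to [a]
    and still passes through [d]. *)
Lemma linked_trans b a d : linked a b -> linked b d -> linked a d.
Proof.
case/orP=> [/eqP->//|/existsP[c /and4P[ab ac bc h]]].
case/orP=> [/eqP<-|/existsP[e /and4P[bd be de k]]].
  exact: linked_cyc3 h.
have [<-|ad] := eqVneq a d; first exact: linkedxx.
have hV : cyc3 a c b \in H by rewrite -cyc3V groupV.
have [<-|cd] := eqVneq c d; first by apply: (@linked_cyc3 a c b); rewrite // eq_sym.
have cb : c != b by rewrite eq_sym.
have := groupJ k hV; rewrite cyc3J; set f := cyc3 a c b.
have fb : f b = a by rewrite cyc3E3.
have fd : f d = d by rewrite cyc3D // eq_sym.
rewrite fb fd; apply: linked_cyc3 => //.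
  by rewrite -fb (inj_eq perm_inj).
by rewrite -fd (inj_eq perm_inj).
Qed.

Lemma linkedJ s a b : s \in 'N(H) -> linked a b -> linked (s a) (s b).
Proof.
move=> sN; case/orP=> [/eqP->|/existsP[c /and4P[ab ac bc h]]]; first exact: linkedxx.
apply: (@linked_cyc3 _ _ (s c)); rewrite ?(inj_eq perm_inj) //.
by rewrite -cyc3J memJ_norm.
Qed.

Hypothesis all_linked : forall a b, linked a b.

(** Linked pairs give some 3-cycle [(a b c)]; a 3-cycle [(c d e)] conjugates it to
    [(a b d)] if [e] is a new point, and inside the alternating group of four
    points otherwise. *)
Lemma all_cyc3 a b d : a != b -> a != d -> b != d -> cyc3 a b d \in H.
Proof.
move=> ab ad bd; have /orP[/eqP|/existsP[c /and4P[_ ac bc h]]] := all_linked a b.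
  by move/eqP; rewrite (negPf ab).
have [<-//|cd] := eqVneq c d.
have /orP[/eqP|/existsP[e /and4P[_ ce de k]]] := all_linked c d.
  by move/eqP; rewrite (negPf cd).
have ca : c != a by rewrite eq_sym.
have cb : c != b by rewrite eq_sym.
have da : d != a by rewrite eq_sym.
have db : d != b by rewrite eq_sym.
have dc : d != c by rewrite eq_sym.
have kV : cyc3 c e d \in H by rewrite -cyc3V groupV.
rewrite -groupV cyc3V.
have [ea|ea] := eqVneq e a.
  have := groupJ h kV; rewrite ea cyc3J cyc3E1 // cyc3E2 // cyc3D // 1?eq_sym //.
  by rewrite -cyc3_rot // -cyc3_rot.
have [eb|eb] := eqVneq e b.
  by have := groupJ h kV; rewrite eb cyc3J cyc3E1 // cyc3E2 // cyc3D // 1?eq_sym.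
rewrite -groupV cyc3V.
have ae : a != e by rewrite eq_sym.
have be : b != e by rewrite eq_sym.
by have := groupJ h k; rewrite cyc3J cyc3E1 // !cyc3D.
Qed.

End Linked.

Section EvenPermutations.

Variable H : {group {perm T}}.
Hypothesis cyc3H : forall a b c : T, a != b -> a != c -> b != c -> cyc3 a b c \in H.

Lemma tperm2_in (a b c d : T) : a != b -> c != d -> tperm a b * tperm c d \in H.
Proof.
have shared x y z : x != y -> x != z -> tperm x y * tperm x z \in H.
  move=> xy xz; have [<-|yz] := eqVneq y z; first by rewrite tperm2 group1.
  exact: cyc3H.
move=> ab cd; have [eac|ac] := eqVneq a c; first by rewrite -eac in cd *; exact: shared.
have -> : tperm a b * tperm c d = (tperm a b * tperm a c) * (tperm c a * tperm c d).
  by rewrite -!mulgA (mulgA (tperm a c)) (tpermC c a) tperm2 mul1g.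
by rewrite groupM ?shared // eq_sym.
Qed.

Lemma even_perm_in (s : {perm T}) : ~~ odd_perm s -> s \in H.
Proof.
have [ts -> tsP] := prod_tpermP s; rewrite odd_perm_prod //.
have [k] := ubnP (size ts); elim: k ts tsP => // k IHk [|t [|t' ts]] //=.
  by rewrite big_nil group1.
case/and3P=> tP tP' tsP lt_k; rewrite negbK => ev.
rewrite !big_cons mulgA groupM ?tperm2_in // IHk //.
exact: leq_trans (leqnSn _) lt_k.
Qed.

End EvenPermutations.

End ThreeCycles.

(** * Generating the group of signed permutations *)

Section Generation.

Local Open Scope group_scope.

Variables (n : nat) (K : {group sperm n}).
Implicit Types (a b g : sperm n) (s : 'S_n).

Definition proj a : 'S_n := a.1.
Canonical proj_morphism := @Morphism _ _ [set: sperm n] proj (in2W (@spermM1 n)).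

Lemma even_neg_group_set : group_set [set a in K | ~~ neg_parity a].
Proof.
apply/group_setP; split=> [|a b]; first by rewrite inE group1 neg_parity1.
rewrite !inE neg_parityM => /andP[aK /negPf->] /andP[bK /negPf->].
by rewrite groupM.
Qed.
Definition even_neg_group := Group even_neg_group_set.

(** The permutations that have a lift in [K] with evenly many signs. *)
Definition even_lifts : {group 'S_n} := (proj @* even_neg_group)%G.

Lemma even_liftsP s :
  reflect (exists a, [/\ a \in K, neg_parity a = false & a.1 = s]) (s \in even_lifts).
Proof.
apply: (iffP morphimP) => [[a _]|[a [aK ea <-]]].
  by rewrite inE => /andP[aK /negPf ea] ->; exists a.
by exists a; rewrite ?inE ?aK ?ea.
Qed.

Lemma even_lifts_norm a : a \in K -> a.1 \in 'N(even_lifts).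
Proof.
move=> aK; rewrite inE; apply/subsetP=> _ /imsetP[s /even_liftsP[b [bK eb <-]] ->].
apply/even_liftsP; exists (b ^ a); split=> //; first by rewrite groupJ.
by rewrite !neg_parityM neg_parityV eb; case: neg_parity.
Qed.

(** The fourth power of a lift of a 3-cycle lies over the same 3-cycle, and its
    number of signs is even. *)
Lemma even_lifts_cyc3 a (i j k : 'I_n) : i != j -> i != k -> j != k ->
  a \in K -> a.1 = cyc3 i j k -> cyc3 i j k \in even_lifts.
Proof.
move=> ij ik jk aK a1; apply/even_liftsP; exists (a ^+ 4); split.
- exact: groupX.
- by rewrite !expgS expg0 mulg1 !neg_parityM; case: neg_parity.
by rewrite spermX1 a1 expgSr cyc3X3 // mul1g.
Qed.

Definition flip (e : {ffun 'I_n -> bool}) : sperm n := (1, e).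
Definition delta2 (i j : 'I_n) : {ffun 'I_n -> bool} := [ffun k => (k == i) (+) (k == j)].

Lemma flipM e f : flip e * flip f = flip [ffun i => e i (+) f i].
Proof.
apply: sperm_eqP => [|i] /=; first exact: mul1g.
by rewrite !ffunE perm1.
Qed.

Lemma flipJ e a : flip e ^ a = flip [ffun i => e (a.1^-1 i)].
Proof.
apply: sperm_eqP => [|i]; first by rewrite /= mul1g mulVg.
by rewrite !spermM2 /= !ffunE /= perm1; case: (a.2 _) (e _) => [] [].
Qed.

Hypothesis all_even_lifts : forall s, ~~ odd_perm s -> s \in even_lifts.

Lemma lift_cyc3 i j k : i != j -> i != k -> exists2 a, a \in K & a.1 = cyc3 i j k.
Proof.
move=> ij ik; have /even_liftsP[a [aK _ a1]] : cyc3 i j k \in even_lifts.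
  by rewrite all_even_lifts // odd_cyc3.
by exists a.
Qed.

Variables (e : {ffun 'I_n -> bool}) (i0 j0 : 'I_n).
Hypotheses (eK : flip e \in K) (ei0 : e i0) (ej0 : e j0 = false).
Variable k0 : 'I_n.
Hypotheses (ik0 : i0 != k0) (jk0 : j0 != k0).

Let ij0 : i0 != j0. Proof. by apply: contraFneq ej0 => <-. Qed.

Definition pair_flip i j := flip (delta2 i j) \in K.

Lemma pair_flipxx i : pair_flip i i.
Proof.
rewrite /pair_flip (_ : flip _ = 1) ?group1 //; apply: sperm_eqP => //= j.
by rewrite !ffunE addbb.
Qed.

Lemma pair_flip_sym i j : pair_flip i j -> pair_flip j i.
Proof. by rewrite /pair_flip; congr (flip _ \in K); apply/ffunP=> k; rewrite !ffunE addbC. Qed.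

Lemma pair_flip_trans j i k : pair_flip i j -> pair_flip j k -> pair_flip i k.
Proof.
move=> ij jk; have := groupM ij jk; rewrite flipM; congr (flip _ \in K).
by apply/ffunP=> l; rewrite !ffunE addbA addbK.
Qed.

Lemma pair_flipJ a i j : a \in K -> pair_flip i j -> pair_flip (a.1 i) (a.1 j).
Proof.
move=> aK ij; have := groupJ ij aK; rewrite flipJ; congr (flip _ \in K).
by apply/ffunP=> l; rewrite !ffunE !(canF_eq (permKV _)).
Qed.

(** The sign change [e] differs from its conjugate by the 3-cycle [(i0 j0 k0)] in
    exactly two places, because [e] takes both values on [i0, j0, k0]. *)
Lemma pair_flip_exists : exists i j, i != j /\ pair_flip i j.
Proof.
have [a aK a1] := lift_cyc3 ij0 ik0.
have := groupM eK (groupJ eK aK); rewrite flipJ flipM a1 cyc3V => fK.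
have c1 : cyc3 i0 k0 j0 i0 = k0 by rewrite cyc3E1 // eq_sym.
have c2 : cyc3 i0 k0 j0 k0 = j0 by rewrite cyc3E2.
have c3 : cyc3 i0 k0 j0 j0 = i0 by rewrite cyc3E3 // eq_sym.
have cD l := @cyc3D _ i0 k0 j0 l.
have [ki0 kj0 ji0] : [/\ k0 != i0, k0 != j0 & j0 != i0] by split; rewrite eq_sym.
pose neqs := (negPf ij0, negPf ik0, negPf jk0, negPf ki0, negPf kj0, negPf ji0).
exists (if e k0 then k0 else i0), j0; split; first by case: ifP => _ //; rewrite eq_sym.
move: fK; rewrite /pair_flip; congr (flip _ \in K); apply/ffunP=> l; rewrite !ffunE.
have [->|li] := eqVneq l i0.
  by rewrite c1 ei0; case: (e k0); rewrite !(eqxx, neqs).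
have [->|lk] := eqVneq l k0.
  by rewrite c2 ej0; case: (e k0); rewrite !(eqxx, neqs).
have [->|lj] := eqVneq l j0.
  by rewrite c3 ei0 ej0; case: (e k0); rewrite !(eqxx, neqs).
by rewrite cD // addbb; case: (e k0); rewrite ?(negPf lk) ?(negPf li).
Qed.

Lemma all_pair_flips i j : pair_flip i j.
Proof.
have [u [v [uv duv]]] := pair_flip_exists.
suff du w : pair_flip u w by apply: (pair_flip_trans (pair_flip_sym (du i)) (du j)).
have [<-|uw] := eqVneq u w; first exact: pair_flipxx.
have [<-//|vw] := eqVneq v w.
have [a aK a1] := lift_cyc3 uv uw.
apply: (pair_flip_trans duv).
by have := pair_flipJ aK duv; rewrite a1 cyc3E1 // cyc3E2.
Qed.

(** An even set of coordinates is the symmetric difference of the pairs [{i, i0}]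
    over its elements [i]. *)
Lemma even_flip_in (f : {ffun 'I_n -> bool}) : ~~ (\big[addb/false]_i f i) -> flip f \in K.
Proof.
move=> ev; pose G i := delta2 i i0.
suff -> : flip f = \prod_(i | f i) flip (G i).
  by apply: group_prod => i _; exact: all_pair_flips.
have <- : flip [ffun l => \big[addb/false]_(i | f i) G i l] = \prod_(i | f i) flip (G i).
  rewrite /index_enum; elim: (Finite.enum _) => [|i r IHr].
    by rewrite big_nil; apply: sperm_eqP => //= l; rewrite !ffunE big_nil.
  rewrite big_cons; case: ifP => fi.
    rewrite -IHr flipM; congr (flip _); apply/ffunP=> l.
    by rewrite !ffunE big_cons fi !ffunE.
  by rewrite -IHr; congr (flip _); apply/ffunP=> l; rewrite !ffunE big_cons fi.
congr (flip _); apply/ffunP=> l; rewrite ffunE.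
rewrite (eq_bigr (fun i => (l == i) (+) (l == i0))); last by move=> i _; rewrite ffunE.
rewrite big_split /= [X in _ (+) X](_ : _ = false) ?addbF.
  rewrite (big_mkcond f) /= (bigD1 l) //= eqxx big1 ?addbF; first by case: (f l).
  by move=> i il; rewrite eq_sym (negPf il); case: (f i).
case: (l == i0); last by rewrite big1.
rewrite big_mkcond /= -[RHS](negbTE ev); apply: eq_bigr => i _.
by case: (f i).
Qed.

Lemma even_in a : ~~ odd_perm a.1 -> ~~ neg_parity a -> a \in K.
Proof.
move=> /all_even_lifts/even_liftsP[b [bK eb b1]] ea.
rewrite -(mulgKV b a) groupMr // (_ : a * b^-1 = flip (a * b^-1).2).
  by apply: even_flip_in; rewrite -/(neg_parity (a * b^-1)) neg_parityM neg_parityV eb addbF.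
by apply: sperm_eqP => //=; rewrite -b1 mulgV.
Qed.

(** The elements [g] and [h] generate the quotient by the kernel treated in
    [even_in], which is [Z/2 x Z/2]. *)
Lemma full_of_classes g h : g \in K -> h \in K ->
  odd_perm g.1 -> ~~ neg_parity g -> neg_parity h -> forall a, a \in K.
Proof.
move=> gK hK og ng nh a.
pose h' := if neg_parity a then h else 1.
pose g' := if odd_perm (a * h').1 then g else 1.
have h'K : h' \in K by rewrite /h'; case: ifP.
have g'K : g' \in K by rewrite /g'; case: ifP.
rewrite -(groupMr _ h'K) -(groupMr _ g'K); apply: even_in.
  rewrite (spermM1 (a * h')) odd_permM /g'.
  by case: ifP => _; rewrite ?og ?odd_perm1.
rewrite !neg_parityM /g' /h'.
by case: (odd_perm _); case: (neg_parity a); rewrite ?neg_parity1 ?nh ?(negPf ng).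
Qed.

End Generation.

(** * Quotients of triangle groups *)

Section TriangleQuotients.

Local Open Scope group_scope.

Section EvalWord.
Variables (I : choiceType) (rels : seq (word I)) (G : groupType) (gen : I -> G).

Definition eval_letter (a : I * bool) : G := if a.2 then (gen a.1)^-1 else gen a.1.
Definition eval_word (w : word I) : G := foldr (fun a g => eval_letter a * g) 1 w.

Lemma eval_word_cat u v : eval_word (u ++ v) = eval_word u * eval_word v.
Proof. by elim: u => [|a u IHu] /=; rewrite ?mul1g // IHu mulgA. Qed.

Lemma eval_word_nseq k i : eval_word (nseq k (i, false)) = gen i ^+ k.
Proof. by elim: k => [|k IHk] /=; rewrite ?expg0 // expgS IHk. Qed.

Hypothesis rels1 : forall w, w \in rels -> eval_word w = 1.

Lemma eval_word_eq u v : word_eq rels u v -> eval_word u = eval_word v.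
Proof.
elim=> {u v} // [u v w _ -> _ -> //|u u' v v' _ euu _ evv|i b].
  by rewrite !eval_word_cat euu evv.
by case: b; rewrite /= /eval_letter /= mulg1 ?mulVg ?mulgV.
Qed.

Definition eval_presented (g : presented rels) : G := eval_word (word_of g).

Lemma eval_class w : eval_presented (class_of rels w) = eval_word w.
Proof. by apply: eval_word_eq; exact: class_of_eq. Qed.

Lemma eval_presentedM : {morph eval_presented : g h / g * h}.
Proof.
move=> g h; rewrite -[g]word_ofK -[h]word_ofK.
have -> : class_of rels (word_of g) * class_of rels (word_of h)
          = class_of rels (word_of g ++ word_of h) by exact: presented_mulE.
by rewrite !eval_class eval_word_cat.
Qed.

End EvalWord.

Lemma triangle_quotient (G : groupType) (p q r : nat) (x y : G) :
  x ^+ p = 1 -> y ^+ q = 1 -> (x * y) ^+ r = 1 ->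
  (forall P : G -> Prop, P 1 -> P x -> P y -> (forall g h, P g -> P h -> P (g * h)) ->
     forall g, P g) ->
  is_quotient_of G (triangle_group p q r).
Proof.
move=> xp yq xyr gen_xy.
pose gen (i : 'I_3) : G :=
  if i == inord 0 then x else if i == inord 1 then y else (x * y)^-1.
have ne10 : (inord 1 == inord 0 :> 'I_3) = false by rewrite -val_eqE /= !inordK.
have ne20 : (inord 2 == inord 0 :> 'I_3) = false by rewrite -val_eqE /= !inordK.
have ne21 : (inord 2 == inord 1 :> 'I_3) = false by rewrite -val_eqE /= !inordK.
have rels1 w : w \in triangle_relators p q r -> eval_word gen w = 1.
  rewrite !inE => /or4P[] /eqP->; rewrite ?eval_word_nseq /gen ?eqxx ?ne10 ?ne20 ?ne21 //.
    by rewrite expVgn xyr invg1.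
  by rewrite /= /eval_letter /= !eqxx ne10 ne20 ne21 mulg1 mulgA mulgV.
pose T : groupType := triangle_group p q r.
pose ev : T -> G := @eval_presented _ (triangle_relators p q r) G gen.
pose evM := isMultiplicative.Build T G ev (eval_presentedM rels1).
pose f : {multiplicative T -> G} := HB.pack ev evM.
have f_class w : f (class_of _ w) = eval_word gen w by exact: eval_class.
exists f; apply: gen_xy => [|||_ _ [s <-] [t <-]].
- by exists (class_of _ [::]); rewrite f_class.
- by exists (class_of _ [:: (inord 0, false)]); rewrite f_class /= /eval_letter /gen eqxx mulg1.
- by exists (class_of _ [:: (inord 1, false)]); rewrite f_class /= /eval_letter /gen ne10 eqxx mulg1.
by exists (s * t); rewrite gmulfM.
Qed.

End TriangleQuotients.

(** * Words acting on signed points *)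

Section WordAction.

Local Open Scope group_scope.

(** If [e x] is the number of steps from [x] to a chosen representative of its
    orbit, then the representatives, which count the orbits, are the zeros of [e]. *)
Lemma odd_perm_orbits (T : finType) (s : {perm T}) (e : T -> nat) :
  (forall x, (s ^+ e (s x)) (s x) = (s ^+ e x) x) ->
  (forall x, e ((s ^+ e x) x) = 0) ->
  odd_perm s = odd (#|T| + #|[pred x | e x == 0]|).
Proof.
pose c x := (s ^+ e x) x => cs ec.
have csk k x : c ((s ^+ k) x) = c x.
  elim: k x => [|k IHk] x; first by rewrite perm1.
  by rewrite expgS permM IHk; exact: cs.
rewrite oddD -/(odd_perm s) /odd_perm; congr (_ (+) odd _).
pose A := [pred x | e x == 0].
have cA x : x \in A -> c x = x by rewrite inE /c => /eqP->; rewrite perm1.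
have -> : porbits s = [set porbit s x | x in A].
  apply/setP=> O; apply/imsetP/imsetP=> [[x _ ->]|[x _ ->]]; last by exists x.
  exists (c x); first by rewrite inE ec.
  by apply/esym/eqP; rewrite eq_porbit_mem mem_porbit.
rewrite card_in_imset // => x y xA yA /eqP; rewrite eq_porbit_mem => /porbitP[k xy].
by rewrite -(cA x) // -(cA y) // xy csk.
Qed.

Section SignedMaps.

(** A signed permutation of [T] is encoded by the map that sends a point to its
    image and to the sign, [true] for minus. *)
Variables (T : eqType) (X Y : T -> T * bool).

(** In words, [false] stands for [X] and [true] for [Y], applied from the left. *)
Fixpoint run (w : seq bool) (p : T) : T * bool :=
  if w is l :: w' then
    let: (q, s) := (if l then Y else X) p in let: (r, t) := run w' q in (r, s (+) t)
  else (p, false).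

Variable pts : seq T.
Hypothesis pts_uniq : uniq pts.
Local Notation n := (size pts).

Definition pt (i : 'I_n) : T := tnth (in_tuple pts) i.

Lemma pt_inj : injective pt.
Proof. by apply/tuple_uniqP. Qed.

Lemma mem_pt i : pt i \in pts.
Proof. exact: mem_tnth. Qed.

Lemma ptP p : reflect (exists i, p = pt i) (p \in pts).
Proof. exact: (@tnthP _ _ (in_tuple pts)). Qed.

Definition represents (F : T -> T * bool) (a : sperm n) :=
  forall i, F (pt i) = (pt (a.1 i), a.2 i).

Lemma represents_exists F : {in pts, forall p, (F p).1 \in pts} ->
  {in pts &, injective (fun p => (F p).1)} -> exists a, represents F a.
Proof.
move=> Fpts Finj.
have /choice[f fE] : forall i, exists j, (F (pt i)).1 = pt j.
  by move=> i; apply/ptP/Fpts/mem_pt.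
have f_inj : injective f.
  by move=> i j fij; apply/pt_inj/Finj; rewrite ?mem_pt // !fE fij.
exists (perm f_inj, [ffun i => (F (pt i)).2]) => i /=.
by rewrite permE ffunE -fE; case: (F _).
Qed.

Lemma represents_inj F a b : represents F a -> represents F b -> a = b.
Proof.
move=> Fa Fb; apply: sperm_eqP => [|i]; last by have := Fa i; rewrite Fb => -[].
by apply/permP=> i; apply: pt_inj; have := Fa i; rewrite Fb => -[].
Qed.

Lemma represents1 : represents (fun p => (p, false)) 1.
Proof. by move=> i; rewrite sperm1E perm1. Qed.

Variables x y : sperm n.
Hypotheses (xX : represents X x) (yY : represents Y y).

Definition word_sperm (w : seq bool) : sperm n :=
  \prod_(l <- w) (if l then y else x).

Lemma represents_run w : represents (run w) (word_sperm w).
Proof.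
rewrite /word_sperm; elim: w => [|l w IHw] i /=; first by rewrite big_nil represents1.
rewrite big_cons; have -> : (if l then Y else X) (pt i) =
    (pt ((if l then y else x).1 i), (if l then y else x).2 i).
  by case: l; [exact: yY | exact: xX].
by rewrite IHw spermM2 permM.
Qed.

Lemma word_sperm_in (K : {group sperm n}) w : x \in K -> y \in K -> word_sperm w \in K.
Proof. by move=> xK yK; apply: group_prod => l _; case: l. Qed.

Lemma word_sperm_nseq k l : word_sperm (nseq k l) = (if l then y else x) ^+ k.
Proof.
by rewrite /word_sperm; elim: k => [|k IHk]; rewrite ?big_nil //= big_cons IHk expgS.
Qed.

Lemma word_sperm_pow k w : word_sperm (flatten (nseq k w)) = word_sperm w ^+ k.
Proof.
rewrite /word_sperm; elim: k => [|k IHk]; first by rewrite big_nil.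
by rewrite /= big_cat IHk expgS.
Qed.

Lemma word_sperm_eq1 w : {in pts, forall p, run w p = (p, false)} -> word_sperm w = 1.
Proof.
move=> w1; apply: represents_inj (represents_run w) _ => i.
by rewrite w1 ?mem_pt // sperm1E perm1.
Qed.

Lemma neg_parity_count w : neg_parity (word_sperm w) = odd (count (fun p => (run w p).2) pts).
Proof.
rewrite -sum1_count big_tnth /neg_parity (big_morph odd oddD (erefl : odd 0 = false)).
rewrite [RHS]big_mkcond /=; apply: eq_bigr => i _.
by rewrite -/(pt i) represents_run /=; case: ((word_sperm w).2 i).
Qed.

Definition walk (w : seq bool) p := (run w p).1.

Lemma walk_pt w i : walk w (pt i) = pt ((word_sperm w).1 i).
Proof. by rewrite /walk represents_run. Qed.

Lemma walkX_pt w k i : iter k (walk w) (pt i) = pt ((word_sperm w ^+ k).1 i).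
Proof.
elim: k i => [|k IHk] i; first by rewrite perm1.
by rewrite iterSr walk_pt IHk expgS permM.
Qed.

Lemma odd_perm_count w (e : T -> nat) :
  {in pts, forall p, iter (e (walk w p)) (walk w) (walk w p) = iter (e p) (walk w) p} ->
  {in pts, forall p, e (iter (e p) (walk w) p) = 0} ->
  odd_perm (word_sperm w).1 = odd (n + count (fun p => e p == 0) pts).
Proof.
move=> e1 e2; rewrite (@odd_perm_orbits _ _ (e \o pt)).
- rewrite card_ord; congr (odd (_ + _)).
  rewrite -sum1_count big_tnth -sum1_card; apply: eq_bigl => i.
  by rewrite inE /= -/(pt i).
- move=> i /=; apply: pt_inj; have := e1 _ (mem_pt i).
  by rewrite walk_pt !walkX_pt !spermX1.
- by move=> i /=; have := e2 _ (mem_pt i); rewrite walkX_pt spermX1.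
Qed.

End SignedMaps.

Section Criterion.

Variables (T : eqType) (pts : seq T) (X Y : T -> T * bool) (p q r : nat).
Local Notation run := (run X Y).
Local Notation walk := (walk X Y).

Hypotheses (pts_uniq : uniq pts) (p0 : 0 < p) (q0 : 0 < q).
Hypothesis closed : {in pts, forall t, (X t).1 \in pts /\ (Y t).1 \in pts}.
Hypothesis relX : {in pts, forall t, run (nseq p false) t = (t, false)}.
Hypothesis relY : {in pts, forall t, run (nseq q true) t = (t, false)}.
Hypothesis relXY : {in pts, forall t, run (flatten (nseq r [:: false; true])) t = (t, false)}.

Variables (w3 : seq bool) (a b c : T).
Hypotheses (a_in : a \in pts) (b_in : b \in pts) (c_in : c \in pts).
Hypotheses (ab : a != b) (ac : a != c) (bc : b != c).
Hypothesis w3a : walk w3 a = b.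
Hypothesis w3b : walk w3 b = c.
Hypothesis w3c : walk w3 c = a.
Hypothesis w3D : {in pts, forall t, t != a -> t != b -> t != c -> walk w3 t = t}.
Hypothesis Xa : (X a).1 \in [:: a; b; c].
Hypothesis Ya : (Y a).1 \in [:: a; b; c].
Hypothesis connected : forall C : T -> Prop, C a ->
  {in pts, forall t, C t -> C (X t).1 /\ C (Y t).1} -> {in pts, forall t, C t}.

Variables (u : seq bool) (d d' : T).
Hypotheses (d_in : d \in pts) (d'_in : d' \in pts).
Hypothesis u_fix : {in pts, forall t, walk u t = t}.
Hypotheses (u_d : (run u d).2) (u_d' : (run u d').2 = false).

Variables (g h : seq bool) (e : T -> nat).
Hypothesis e_walk :
  {in pts, forall t, iter (e (walk g t)) (walk g) (walk g t) = iter (e t) (walk g) t}.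
Hypothesis e_rep : {in pts, forall t, e (iter (e t) (walk g) t) = 0}.
Hypothesis g_odd : odd (size pts + count (fun t => e t == 0) pts).
Hypothesis g_even : ~~ odd (count (fun t => (run g t).2) pts).
Hypothesis h_odd : odd (count (fun t => (run h t).2) pts).

(** The hypotheses on [w3] and [connected] give the even permutations, those on [u]
    the even sign changes, and those on [g] and [h] the two remaining classes. *)
Lemma quotient_criterion :
  is_quotient_of (hyperoctahedral (size pts)) (triangle_group p q r).
Proof.
have Xinj : {in pts &, injective (fun t => (X t).1)}.
  move=> s t sp tp /= XsXt; have := congr1 fst (relX sp); have := congr1 fst (relX tp).
  rewrite -(prednK p0) /=; case: (X s) (X t) XsXt => [s' ?] [t' ?] /= ->.
  by case: (run _ t') => ? ? /= -> ->.
have Yinj : {in pts &, injective (fun t => (Y t).1)}.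
  move=> s t sp tp /= YsYt; have := congr1 fst (relY sp); have := congr1 fst (relY tp).
  rewrite -(prednK q0) /=; case: (Y s) (Y t) YsYt => [s' ?] [t' ?] /= ->.
  by case: (run _ t') => ? ? /= -> ->.
have [x xX] := represents_exists pts_uniq (fun t tp => (closed tp).1) Xinj.
have [y yY] := represents_exists pts_uniq (fun t tp => (closed tp).2) Yinj.
pose ev := word_sperm x y.
have ev_rep w := represents_run xX yY w.
have ev1 w := @word_sperm_eq1 _ _ _ _ pts_uniq _ _ xX yY w.
have hypX z k : to_hyp (z ^+ k) = to_hyp z ^+ k :> hyperoctahedral (size pts).
  by elim: k => [|k IHk]; rewrite ?expg0 ?to_hyp1 // !expgS to_hypM IHk.
apply: (@triangle_quotient _ p q r (to_hyp x) (to_hyp y)).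
- have := ev1 _ relX; rewrite /ev word_sperm_nseq => x1.
  by rewrite -hypX x1 to_hyp1.
- have := ev1 _ relY; rewrite /ev word_sperm_nseq => y1.
  by rewrite -hypX y1 to_hyp1.
- have := ev1 _ relXY; rewrite /ev word_sperm_pow {1}/word_sperm !big_cons big_nil mulg1 => xy1.
  by rewrite -to_hypM -hypX xy1 to_hyp1.
move=> P P1 Px Py PM g0; have [a0 <-] := to_hyp_surj g0 => {g0}.
have K_group : group_set [set s : sperm (size pts) | `[< P (to_hyp s) >]].
  apply/group_setP; split=> [|s t]; rewrite !inE; first by rewrite to_hyp1; apply/asboolP.
  by move=> /asboolP Ps /asboolP Pt; apply/asboolP; rewrite to_hypM; apply: PM.
pose K := Group K_group.
have xK : x \in K by rewrite inE; apply/asboolP.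
have yK : y \in K by rewrite inE; apply/asboolP.
have evK w : ev w \in K by exact: word_sperm_in.
suff : a0 \in K by rewrite inE => /asboolP.
have sh w i : walk w (pt i) = pt ((ev w).1 i) by exact: walk_pt.
have pinj := pt_inj pts_uniq.
have [ia Ea] := ptP _ _ a_in; have [ib Eb] := ptP _ _ b_in; have [ic Ec] := ptP _ _ c_in.
have nab : ia != ib by apply: contraNneq ab => E; rewrite Ea Eb E.
have nac : ia != ic by apply: contraNneq ac => E; rewrite Ea Ec E.
have nbc : ib != ic by apply: contraNneq bc => E; rewrite Eb Ec E.
have w3E : (ev w3).1 = cyc3 ia ib ic.
  apply: cyc3_eq => // [|||i iA iB iC]; apply: (pinj); rewrite -sh -?Ea -?Eb -?Ec //.
  by rewrite w3D ?mem_pt // ?Ea ?Eb ?Ec (inj_eq pinj).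
have c3 := even_lifts_cyc3 nab nac nbc (evK w3) w3E.
have lab : linked (even_lifts K) ia ib by exact: linked_cyc3 c3.
have lac : linked (even_lifts K) ia ic.
  apply: linked_trans lab _; apply: (@linked_cyc3 _ _ ib ic ia) => //.
  - by rewrite eq_sym.
  - by rewrite eq_sym.
  by rewrite -cyc3_rot.
have la_all i : linked (even_lifts K) ia i.
  suff : forall t, t \in pts -> forall j, t = pt j -> linked (even_lifts K) ia j.
    by move/(_ _ (mem_pt i) i); apply.
  have la t j : t \in [:: a; b; c] -> t = pt j -> linked (even_lifts K) ia j.
    rewrite !inE Ea Eb Ec => /or3P[] /eqP-> /(pt_inj pts_uniq) <- //; exact: linkedxx.
  apply: connected => [j|t tp lt]; first by rewrite Ea => /(pt_inj pts_uniq) <-; exact: linkedxx.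
  have [k tk] := ptP _ _ tp; have {}lt := lt _ tk.
  split=> j; rewrite tk.
    rewrite xX => /(pt_inj pts_uniq) <-; apply: (@linked_trans _ _ (x.1 ia)).
      by apply: (la (X a).1); rewrite // Ea xX.
    by apply: linkedJ lt; exact: even_lifts_norm.
  rewrite yY => /(pt_inj pts_uniq) <-; apply: (@linked_trans _ _ (y.1 ia)).
    by apply: (la (Y a).1); rewrite // Ea yY.
  by apply: linkedJ lt; exact: even_lifts_norm.
have all_l i j : linked (even_lifts K) i j.
  exact: linked_trans (linked_sym (la_all i)) (la_all j).
have even_in_K s : ~~ odd_perm s -> s \in even_lifts K.
  by apply: even_perm_in => i j k; exact: all_cyc3.
have [id Ed] := ptP _ _ d_in; have [id' Ed'] := ptP _ _ d'_in.
have uE : ev u = flip (ev u).2.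
  apply: sperm_eqP => //=; apply/permP=> i; apply: (pinj).
  by rewrite -sh u_fix ?mem_pt // perm1.
have sgn w i : (run w (pt i)).2 = (ev w).2 i by rewrite ev_rep.
have [k [dk d'k]] : exists k, id != k /\ id' != k.
  have [E|n1] := eqVneq id ia; have [E'|n2] := eqVneq id' ia.
  - by exists ib; rewrite E E'.
  - have [E2|n3] := eqVneq id' ib; first by exists ic; rewrite E E2.
    by exists ib; rewrite E.
  - have [E2|n3] := eqVneq id ib; first by exists ic; rewrite E' E2.
    by exists ib; rewrite E'.
  by exists ia.
apply: (@full_of_classes _ K even_in_K (ev u).2 id id' _ _ _ k dk d'k (ev g) (ev h)) => //.
- by rewrite -uE.
- by rewrite -sgn -Ed.
- by rewrite -sgn -Ed'.
- by rewrite (odd_perm_count _ xX yY e_walk e_rep).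
- by rewrite (neg_parity_count xX yY).
by rewrite (neg_parity_count xX yY).
Qed.

End Criterion.

End WordAction.

(** * Chains of blocks *)

(** The lists [bX] and [bY] are the value tables of [X] and [Y] on the points below
    [bsize]; [bXneg] and [bYneg] are the points at which [X] and [Y] have a minus sign. *)
Record block := Block {
  bsize : nat; bX : seq nat; bY : seq nat; bXneg : seq nat; bYneg : seq nat }.

Definition apply_cycles (cs : seq (seq nat)) (j : nat) : nat :=
  foldr (fun c i => next c i) j cs.

Definition mk_block sz (xs ys : seq (seq nat)) (xneg yneg : seq nat) : block :=
  Block sz (mkseq (apply_cycles xs) sz) (mkseq (apply_cycles ys) sz) xneg yneg.

(** The ports are 0 and 3. They lie in different 3-cycles of [XY], so that a
    neighbour on either side turns one of the 3-cycles into a 6-cycle. *)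
Definition middle : block := Eval vm_compute in
  mk_block 6 [:: [:: 1; 2]; [:: 4; 5]] [:: [:: 0; 1; 3; 5]; [:: 2; 4]] [::] [::].

(** The point [(l, j, r)] is the point [j] of the block that has [l] blocks on its left
    and [r] blocks on its right. *)
Definition point : Type := nat * nat * nat.
HB.instance Definition _ := Equality.on point.

Section Diagram.

Variables (L R : block).

Definition block_at (l r : nat) : block :=
  match l, r with 0, _ => L | _, 0 => R | _, _ => middle end.

Definition right_port (l : nat) : nat := if l is 0 then 0 else 3.

(** Neighbouring blocks are joined by [X], which swaps the right port of one with the
    port 0 of the next. *)
Definition stepX (t : point) : point * bool :=
  let: (l, j, r) := t in
  let stay := ((l, nth 0 (bX (block_at l r)) j, r), j \in bXneg (block_at l r)) in
  let go_left := if l is l'.+1 then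
      if j == 0 then ((l', right_port l', r.+1), false) else stay else stay in
  if r is r'.+1 then
    if j == right_port l then ((l.+1, 0, r'), false) else go_left
  else go_left.

Definition stepY (t : point) : point * bool :=
  let: (l, j, r) := t in
  ((l, nth 0 (bY (block_at l r)) j, r), j \in bYneg (block_at l r)).

Definition block_points (l r : nat) : seq point :=
  [seq (l, j, r) | j <- iota 0 (bsize (block_at l r))].

Definition points (N : nat) : seq point :=
  flatten [seq block_points l (N - l) | l <- iota 0 N.+1].

Lemma points_uniq N : uniq (points N).
Proof.
rewrite /points; set s := iota 0 _; have : uniq s by exact: iota_uniq.
elim: s => //= l s IHs /andP[ls us].
rewrite cat_uniq IHs // andbT map_inj_in_uniq ?iota_uniq; last by move=> i j _ _ [].
apply/hasPn=> t /flatten_mapP[l' l's /mapP[j _ ->]]; apply/mapP=> -[i _ [El _ _]].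
by rewrite -El l's in ls.
Qed.

Lemma mem_points N l j r :
  ((l, j, r) \in points N) = (l + r == N) && (j < bsize (block_at l r)).
Proof.
apply/flatten_mapP/andP=> [[l' l'N /mapP[i iB [-> -> ->]]]|[/eqP<- jB]].
  by move: l'N iB; rewrite !mem_iota; split=> //; lia.
exists l; first by rewrite mem_iota; lia.
have -> : l + r - l = r by lia.
by apply/mapP; exists j; rewrite ?mem_iota.
Qed.

Lemma points_ind N (P : point -> Prop) :
  (forall l r, l + r = N -> {in block_points l r, forall t, P t}) ->
  {in points N, forall t, P t}.
Proof.
move=> PB [[l j] r]; rewrite mem_points => /andP[/eqP lr jB].
by apply: (PB l r lr); apply/mapP; exists j; rewrite ?mem_iota.
Qed.

Lemma mem_block_points l r t : t \in block_points l r -> t \in points (l + r).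
Proof. by case/mapP=> j; rewrite mem_iota add0n => jB ->; rewrite mem_points eqxx. Qed.

Lemma block_pointsP l r (U : eqType) (F G : point -> U) :
  map F (block_points l r) = map G (block_points l r) ->
  {in block_points l r, forall t, F t = G t}.
Proof. by move/eq_in_map. Qed.

Lemma count_points0 P : count P (points 0) = count P (block_points 0 0).
Proof. by rewrite /points /= cats0. Qed.

Lemma count_pointsS P N : count P (points N.+1) = count P (block_points 0 N.+1)
  + \sum_(1 <= l < N.+1) count P (block_points l (N.+1 - l)) + count P (block_points N.+1 0).
Proof.
rewrite /points -[N.+2]addn1 iotaD map_cat flatten_cat count_cat /= cats0 subn0 subnn.
rewrite count_cat; congr (_ + _ + _).
by rewrite count_flatten sumnE !big_map /index_iota subSS subn0.
Qed.

Lemma odd_count_points P N :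
  (forall l r, odd (count P (block_points l.+1 r.+1)) = false) ->
  odd (count P (points N.+1))
  = odd (count P (block_points 0 N.+1) + count P (block_points N.+1 0)).
Proof.
move=> Pmid; rewrite count_pointsS -addnA (addnC (\sum_(_ <= _ < _) _)) addnA oddD.
rewrite [X in _ (+) X](_ : _ = false) ?addbF // big_nat.
rewrite (big_morph odd oddD (erefl : odd 0 = false)) big1 // => l /andP[l0 lN].
by rewrite -(prednK l0) (_ : _ - _ = (N - l).+1) ?Pmid //; lia.
Qed.

Lemma size_points N : size (points N.+1) = bsize L + 6 * N + bsize R.
Proof.
have cB l r : count predT (block_points l r) = bsize (block_at l r).
  by rewrite count_predT size_map size_iota.
rewrite -[LHS]count_predT count_pointsS (cB 0) (cB N.+1 0).
congr (_ + _ + _); transitivity (\sum_(1 <= l < N.+1) 6).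
  apply: eq_big_nat => l /andP[l0 lN]; rewrite cB.
  by case: l l0 lN => // l _ lN; rewrite subSS -[N - l]prednK ?subn_gt0.
by rewrite sum_nat_const_nat subSS subn0 mulnC.
Qed.

Lemma stepX_sum l j r l' j' r' b : stepX (l, j, r) = ((l', j', r'), b) -> l' + r' = l + r.
Proof.
rewrite /stepX; case: r => [|r]; case: l => [|l]; do ?case: eqP => _; case=> <- _ <- _; lia.
Qed.

Lemma stepX_right l r : (stepX (l, right_port l, r.+1)).1 = (l.+1, 0, r).
Proof. by rewrite /stepX eqxx. Qed.

Section Certified.

Variables (q r0 : nat) (w3 u g h : seq bool) (a b c d d' : nat).

Local Notation run := (run stepX stepY).
Local Notation walk := (walk stepX stepY).

Definition rotate3 (t : point) : point :=
  let: (l, j, r) := t in (l, if l is 0 then next [:: a; b; c] j else j, r).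

(** The number of steps along [g] to the point of the orbit that is least in its
    block, for a word [g] that preserves the blocks and has orbits of at most 12
    points. *)
Definition to_least (t : point) : nat :=
  let: (l, _, r) := t in
  let orbit := traject (fun j => (walk g (l, j, r)).1.2) t.1.2 12 in
  index (foldr minn t.1.2 orbit) orbit.

(** One round of a breadth-first search; each point is paired with a word leading to it. *)
Definition grow_tree (B : block) (tree : seq (nat * seq bool)) : seq (nat * seq bool) :=
  let add tr jw := if jw.1 \in unzip1 tr then tr else rcons tr jw in
  foldl (fun tr jw => add (add tr (nth 0 (bX B) jw.1, rcons jw.2 false))
                          (nth 0 (bY B) jw.1, rcons jw.2 true)) tree tree.

Definition paths (B : block) (j : nat) : seq (seq bool) :=
  let tree := iter (bsize B) (grow_tree B) [:: (j, [::])] in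
  [seq nth [::] (unzip2 tree) (index i (unzip1 tree)) | i <- iota 0 (bsize B)].

Definition entry l := if l is 0 then a else 0.

Definition in_block (t : point) : bool :=
  let: (l, j, r) := t in j < bsize (block_at l r).

(** The hypotheses of [quotient_criterion] on the points of one block, as equations
    between lists, so that they can be decided by evaluation even if [l] and [r] contain
    variables. *)
Record locally_certified l r : Prop := LocallyCertified {
  steps_inside : all (fun t => in_block (stepX t).1 && in_block (stepY t).1) (block_points l r);
  X_relation : map (run (nseq 2 false)) (block_points l r)
      = map (fun t => (t, false)) (block_points l r);
  Y_relation : map (run (nseq q true)) (block_points l r)
      = map (fun t => (t, false)) (block_points l r);
  XY_relation : map (run (flatten (nseq r0 [:: false; true]))) (block_points l r)
      = map (fun t => (t, false)) (block_points l r);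
  acts_as_3cycle : map (walk w3) (block_points l r) = map rotate3 (block_points l r);
  acts_as_signs : map (walk u) (block_points l r) = map id (block_points l r);
  least_invariant :
      map (fun t => iter (to_least (walk g t)) (walk g) (walk g t)) (block_points l r)
      = map (fun t => iter (to_least t) (walk g) t) (block_points l r);
  least_idem : map (fun t => to_least (iter (to_least t) (walk g) t)) (block_points l r)
      = map (fun=> 0) (block_points l r);
  block_connected :
      map (fun v => walk v (l, entry l, r)) (paths (block_at l r) (entry l)) = block_points l r;
  ports_inside : (entry l < bsize (block_at l r))
      && ((r == 0) || (right_port l < bsize (block_at l r))) }.

Record head_certified r : Prop := HeadCertified {
  _ : all (fun j => j < bsize L) [:: a; b; c; d; d'];
  _ : uniq [:: a; b; c];
  _ : (stepX (0, a, r)).1 = (0, nth 0 (bX L) a, r);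
  _ : (nth 0 (bX L) a \in [:: a; b; c]) && (nth 0 (bY L) a \in [:: a; b; c]);
  _ : (run u (0, d, r)).2 = true;
  _ : (run u (0, d', r)).2 = false }.

Lemma steps_in_points N : (forall l r, l + r = N -> locally_certified l r) ->
  {in points N, forall t, (stepX t).1 \in points N /\ (stepY t).1 \in points N}.
Proof.
move=> cert; apply: points_ind => l r lr t tB.
have [/allP/(_ t tB)/andP[] + + _ _ _ _ _ _ _ _ _] := cert l r lr.
have [j _ ->] := mapP tB; case Es: (stepX (l, j, r)) => [[[l' j'] r'] e] /= Xin Yin.
by rewrite !mem_points (stepX_sum Es) lr eqxx.
Qed.

Lemma closed_connected N (C : point -> Prop) :
  (forall l r, l + r = N -> locally_certified l r) ->
  C (0, a, N) ->
  {in points N, forall t, C t -> C (stepX t).1 /\ C (stepY t).1} ->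
  {in points N, forall t, C t}.
Proof.
move=> cert Ca Cstep.
have closed : {in points N, forall t, (stepX t).1 \in points N /\ (stepY t).1 \in points N}.
  exact: steps_in_points.
have word w t : t \in points N -> C t -> C (walk w t).
  rewrite /walk; elim: w t => //= x w IHw t tN Ct.
  have [XN YN] := closed _ tN; have [CX CY] := Cstep t tN Ct.
  case: x; [case: (stepY t) YN CY | case: (stepX t) XN CX] => s e /= sN Cs;
    by have := IHw s sN Cs; case: (run w s).
have enter l r : l + r = N -> C (l, entry l, r) -> {in block_points l r, forall t, C t}.
  move=> lr Ce t; have [_ _ _ _ _ _ _ _ <- /andP[eB _]] := cert l r lr.
  by case/mapP=> v _ ->; apply: word; rewrite // mem_points lr eqxx.
apply: points_ind => l; elim: l => [|l IHl] r lr; apply: enter => //.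
  by move: Ca; rewrite -lr add0n.
have lr' : l + r.+1 = N by rewrite -lr addnS.
rewrite /entry -stepX_right; have [_ _ _ _ _ _ _ _ _ /andP[_ pB]] := cert l r.+1 lr'.
have pN : (l, right_port l, r.+1) \in block_points l r.+1.
  by apply/mapP; exists (right_port l); rewrite // mem_iota.
by apply: (proj1 (Cstep _ _ _)); [rewrite -lr'; apply: mem_block_points | apply: IHl pN].
Qed.

Lemma diagram_quotient N : 0 < q ->
  (forall l r, l + r = N -> locally_certified l r) -> head_certified N ->
  odd (size (points N) + count (fun t => to_least t == 0) (points N)) ->
  ~~ odd (count (fun t => (run g t).2) (points N)) ->
  odd (count (fun t => (run h t).2) (points N)) ->
  is_quotient_of (hyperoctahedral (size (points N))) (triangle_group 2 q r0).
Proof.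
move=> q0 cert [/allP Lin uniq3 Xa abc_a ud ud'] g_odd g_even h_odd.
have inN j : j \in [:: a; b; c; d; d'] -> (0, j, N) \in points N.
  by move/Lin => jL; rewrite mem_points eqxx.
move: (uniq3); rewrite /= !inE negb_or -!andbA => /and4P[ab ac bc _].
have everywhere (U : eqType) (F G : point -> U) :
    (forall l r, l + r = N -> map F (block_points l r) = map G (block_points l r)) ->
    {in points N, forall t, F t = G t}.
  by move=> FG; apply: points_ind => l r lr; apply: block_pointsP; exact: FG.
have w3E : {in points N, forall t, walk w3 t = rotate3 t}.
  by apply: everywhere => l r /cert[].
have [/inN aN /inN bN /inN cN] : [/\ a \in [:: a; b; c; d; d'],
    b \in [:: a; b; c; d; d'] & c \in [:: a; b; c; d; d']].
  by rewrite !inE !eqxx !orbT.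
have neq (j k : nat) : j != k -> (0, j, N) != (0, k, N) by apply: contraNneq => -[->].
have in3 j : j \in [:: a; b; c] -> (0, j, N) \in [:: (0, a, N); (0, b, N); (0, c, N)].
  exact: (map_f (fun j => (0, j, N))).
apply: (@quotient_criterion _ (points N) stepX stepY 2 q r0 _ _ q0 (steps_in_points cert)
  _ _ _ w3 (0, a, N) (0, b, N) (0, c, N) aN bN cN
  (neq _ _ ab) (neq _ _ ac) (neq _ _ bc) _ _ _ _ _ _ (fun C => @closed_connected N C cert)
  u (0, d, N) (0, d', N) _ _ _ ud ud' g h to_least _ _ g_odd g_even h_odd) => //.
- exact: points_uniq.
- by apply: everywhere => l r /cert[].
- by apply: everywhere => l r /cert[].
- by apply: everywhere => l r /cert[].
- by rewrite w3E //= eqxx.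
- by rewrite w3E //= eq_sym (negPf ab) eqxx.
- by rewrite w3E //= !(eq_sym c) (negPf ac) (negPf bc) eqxx.
- move=> [[l j] r] tN; rewrite w3E //=; case: l tN => [|l] // tN.
  have rN : r = N by move: tN; rewrite mem_points add0n => /andP[/eqP].
  rewrite rN => ja jb jc; congr (_, _, _).
  have ne k : (0, j, N) != (0, k, N) -> j == k = false.
    by move=> jk; apply: contraNF jk => /eqP->.
  by rewrite !ne.
- by rewrite Xa; apply: in3; case/andP: abc_a.
- by apply: in3; case/andP: abc_a.
- by apply: inN; rewrite !inE eqxx !orbT.
- by apply: inN; rewrite !inE eqxx !orbT.
- by apply: everywhere => l r /cert[].
- by apply: everywhere => l r /cert[].
by apply: everywhere => l r /cert[].
Qed.

End Certified.

End Diagram.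

(** * Certificates *)

(** The word [X Y^k1 X Y^k2 ...]. *)
Definition syllables (ks : seq nat) : seq bool :=
  flatten [seq false :: nseq k true | k <- ks].

Definition inv_word (q : nat) (v : seq bool) : seq bool :=
  flatten [seq if l then nseq q.-1 true else [:: false] | l <- rev v].

(** A power of [cyc_word], conjugated by [mover], is a 3-cycle on [ca], [cb], [cc]; a power of
    [sgn_word] changes signs, at [neg_pt] but not at [pos_pt]; [odd_word] is an odd
    permutation with evenly many signs, and [neg_word] has an odd number of signs. *)
Record certificate := Certificate {
  ca : nat; cb : nat; cc : nat; mover : seq bool; cyc_word : seq nat; cyc_pow : nat;
  sgn_word : seq nat; sgn_pow : nat; neg_pt : nat; pos_pt : nat;
  odd_word : seq bool; neg_word : seq bool }.

Section Certify.

Variables (L R : block) (q r0 : nat) (C : certificate).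

Definition three_cycle_word : seq bool :=
  inv_word q (mover C) ++ flatten (nseq (cyc_pow C) (syllables (cyc_word C))) ++ mover C.

Definition sign_word : seq bool := flatten (nseq (sgn_pow C) (syllables (sgn_word C))).

Definition block_certified l r :=
  locally_certified L R q r0 three_cycle_word sign_word (odd_word C) (ca C) (cb C) (cc C) l r.

Definition ends_certified r :=
  head_certified L R sign_word (ca C) (cb C) (cc C) (neg_pt C) (pos_pt C) r.

Definition orbit_reps (t : point) : bool := to_least L R (odd_word C) t == 0.
Definition neg_at (w : seq bool) (t : point) : bool := (run (stepX L R) (stepY L R) w t).2.

Lemma single_block_quotient : 0 < q ->
  block_certified 0 0 -> ends_certified 0 ->
  odd (bsize L + count orbit_reps (block_points L R 0 0)) ->
  ~~ odd (count (neg_at (odd_word C)) (block_points L R 0 0)) ->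
  odd (count (neg_at (neg_word C)) (block_points L R 0 0)) ->
  is_quotient_of (hyperoctahedral (bsize L)) (triangle_group 2 q r0).
Proof.
move=> q0 cert ends o e h.
have sz : size (points L R 0) = bsize L by rewrite /points /= cats0 size_map size_iota.
have N0 l r : l + r = 0 -> block_certified l r by move/eqP; rewrite addn_eq0 => /andP[/eqP-> /eqP->].
rewrite -sz; apply: (diagram_quotient (h := neg_word C) q0 N0 ends); rewrite ?sz ?count_points0 //.
Qed.

(** Middle blocks contribute evenly many orbits and signs, so the parities are those of
    the two ends. *)
Lemma chain_quotient m : 0 < q ->
  (forall l r, 0 < l + r -> block_certified l r) -> ends_certified m.+1 ->
  (forall l r, [/\ odd (count orbit_reps (block_points L R l.+1 r.+1)) = false,
     odd (count (neg_at (odd_word C)) (block_points L R l.+1 r.+1)) = false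
   & odd (count (neg_at (neg_word C)) (block_points L R l.+1 r.+1)) = false]) ->
  odd (bsize L + bsize R + (count orbit_reps (block_points L R 0 m.+1)
       + count orbit_reps (block_points L R m.+1 0))) ->
  ~~ odd (count (neg_at (odd_word C)) (block_points L R 0 m.+1)
          + count (neg_at (odd_word C)) (block_points L R m.+1 0)) ->
  odd (count (neg_at (neg_word C)) (block_points L R 0 m.+1)
       + count (neg_at (neg_word C)) (block_points L R m.+1 0)) ->
  is_quotient_of (hyperoctahedral (bsize L + 6 * m + bsize R)) (triangle_group 2 q r0).
Proof.
move=> q0 cert ends mid o e h.
have certN l r : l + r = m.+1 -> block_certified l r by move=> lr; apply: cert; rewrite lr.
rewrite -size_points; apply: (diagram_quotient (h := neg_word C) q0 certN ends).
- rewrite oddD odd_count_points => [|l r]; last by case: (mid l r).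
  by rewrite size_points addnAC oddD oddM addbF -oddD.
- by rewrite odd_count_points // => l r; case: (mid l r).
by rewrite odd_count_points // => l r; case: (mid l r).
Qed.

End Certify.

Ltac compute_single B q r C :=
  apply: (@single_block_quotient B B q r C);
  [ by []
  | split; by vm_compute
  | split; by vm_compute
  | by vm_compute | by vm_compute | by vm_compute ].

(** The words of the certificates do not look further than five blocks: once [l] and [r] are
    numerals or at least 5, both sides of each equation have the same normal form. *)
Ltac compute_chain L R C m :=
  apply: (@chain_quotient L R 4 6 C m);
  [ by []
  | intros l r;
    case: l => [|[|[|[|[|l]]]]]; case: r => [|[|[|[|[|r]]]]] // _; split; by vm_compute
  | case: m => [|[|[|[|[|m]]]]]; split; by vm_compute
  | intros l r; split; by vm_compute
  | by vm_compute | by vm_compute | by vm_compute ].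

(** * The chains *)

Definition tail3 : block := Eval vm_compute in
  mk_block 3 [:: [:: 1; 2]] [:: [:: 0; 1]] [::] [::].

(** The heads come from an enumeration of the planar diagrams with one port. Their signs are
    placed such that [Y] is an odd permutation with evenly many signs and [X] has an odd
    number of signs: these two classes do not depend on the length of the chain. *)
Definition head0 : block := Eval vm_compute in
  mk_block 18
    [:: [:: 1; 2]; [:: 3; 5]; [:: 4; 6]; [:: 7; 9]; [:: 10; 13]; [:: 11; 14]; [:: 12; 16]]
    [:: [:: 0; 1; 3; 6]; [:: 2; 4; 7; 10]; [:: 5; 8; 11; 15]; [:: 9; 12; 13; 17]; [:: 14; 16]]
    [:: 15] [:: 9; 17].

Definition cert_head0 : certificate :=
  Certificate 17 10 9 [:: true; true; false] [:: 1; 2; 1; 3] 20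
    [:: 1; 2; 2; 2] 12 4 0 [:: true] [:: false].

Lemma chain0 m : is_quotient_of (hyperoctahedral (18 + 6 * m + 6)) (triangle_group 2 4 6).
Proof. compute_chain head0 middle cert_head0 m. Qed.

Definition head1 : block := Eval vm_compute in
  mk_block 16
    [:: [:: 1; 2]; [:: 4; 5]; [:: 6; 7]; [:: 8; 10]; [:: 11; 12]; [:: 13; 14]]
    [:: [:: 0; 1; 3; 5]; [:: 2; 4; 6; 8]; [:: 7; 9; 10; 11]; [:: 12; 13; 14; 15]]
    [:: 15] [:: 13; 14].

Definition cert_head1 : certificate :=
  Certificate 9 14 10 [:: true; false] [:: 1; 2; 1; 3; 2; 2; 3] 10
    [:: 1; 2; 2; 1; 3] 6 4 0 [:: true] [:: false].

Lemma chain1 m : is_quotient_of (hyperoctahedral (16 + 6 * m + 3)) (triangle_group 2 4 6).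
Proof. compute_chain head1 tail3 cert_head1 m. Qed.

Definition head2 : block := Eval vm_compute in
  mk_block 20
    [:: [:: 1; 2]; [:: 3; 5]; [:: 4; 6]; [:: 7; 9]; [:: 8; 10]; [:: 11; 13]; [:: 14; 17]; [:: 16; 18]]
    [:: [:: 0; 1; 3; 6]; [:: 2; 4; 7; 10]; [:: 5; 8; 11; 14]; [:: 9; 12; 15; 17]; [:: 13; 16; 19; 18]]
    [:: 16; 18; 19] [:: 5; 11].

Definition cert_head2 : certificate :=
  Certificate 19 1 18 [:: false] [:: 1; 2; 1; 3] 44
    [:: 1; 3] 36 11 0 [:: true] [:: false].

Lemma chain2 m : is_quotient_of (hyperoctahedral (20 + 6 * m + 6)) (triangle_group 2 4 6).
Proof. compute_chain head2 middle cert_head2 m. Qed.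

Definition head3 : block := Eval vm_compute in
  mk_block 18
    [:: [:: 1; 2]; [:: 3; 5]; [:: 4; 6]; [:: 7; 8]; [:: 9; 10]; [:: 12; 13]; [:: 14; 15]; [:: 16; 17]]
    [:: [:: 0; 1; 3; 6]; [:: 2; 4; 7; 9]; [:: 8; 10; 11; 12]; [:: 13; 14; 16; 15]]
    [:: 11] [:: 5; 8; 11; 17].

Definition cert_head3 : certificate :=
  Certificate 11 13 12 [::] [:: 1; 2; 2; 1; 3] 40
    [:: 1; 3] 30 1 0 [:: true] [:: false].

Lemma chain3 m : is_quotient_of (hyperoctahedral (18 + 6 * m + 3)) (triangle_group 2 4 6).
Proof. compute_chain head3 tail3 cert_head3 m. Qed.

Definition head4 : block := Eval vm_compute in
  mk_block 16
    [:: [:: 1; 2]; [:: 3; 5]; [:: 4; 6]; [:: 7; 8]; [:: 9; 11]; [:: 10; 12]; [:: 14; 15]]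
    [:: [:: 0; 1; 3; 6]; [:: 2; 4]; [:: 5; 7; 9; 12]; [:: 8; 10]; [:: 11; 13; 14; 15]]
    [:: 13; 14; 15] [:: 4; 8].

Definition cert_head4 : certificate :=
  Certificate 13 14 6 [:: true; false] [:: 1; 2; 3; 2] 10
    [:: 1; 3; 1; 3; 2; 2] 6 0 2 [:: true] [:: false].

Lemma chain4 m : is_quotient_of (hyperoctahedral (16 + 6 * m + 6)) (triangle_group 2 4 6).
Proof. compute_chain head4 middle cert_head4 m. Qed.

Definition head5 : block := Eval vm_compute in
  mk_block 20
    [:: [:: 1; 2]; [:: 3; 5]; [:: 4; 6]; [:: 7; 8]; [:: 9; 11]; [:: 10; 12]; [:: 13; 15]; [:: 14; 16]; [:: 17; 18]]
    [:: [:: 0; 1; 3; 6]; [:: 2; 4]; [:: 5; 7; 9; 12]; [:: 8; 10; 13; 16]; [:: 11; 14]; [:: 15; 17; 19; 18]]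
    [:: 17; 18; 19] [:: 4; 8; 11; 13].

Definition cert_head5 : certificate :=
  Certificate 13 15 16 [:: true; false; true; false; true; true; false; true; true] [:: 1; 2; 3; 2] 28
    [:: 1; 3] 51 0 1 [:: true] [:: false].

Lemma chain5 m : is_quotient_of (hyperoctahedral (20 + 6 * m + 3)) (triangle_group 2 4 6).
Proof. compute_chain head5 tail3 cert_head5 m. Qed.

(** * Single diagrams *)

Definition block3 : block := Eval vm_compute in
  mk_block 3
    [:: [:: 1; 2]]
    [:: [:: 0; 1]]
    [::] [:: 1].

Definition cert3 : certificate :=
  Certificate 0 1 2 [::] [:: 1] 1
    [:: 2] 2 1 0 [:: false] [:: true].

Lemma single3 : is_quotient_of (hyperoctahedral 3) (triangle_group 2 4 6).
Proof. compute_single block3 4 6 cert3. Qed.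

Definition block4 : block := Eval vm_compute in
  mk_block 4
    [:: [:: 2; 3]]
    [:: [:: 0; 1; 2; 3]]
    [:: 1] [::].

Definition cert4 : certificate :=
  Certificate 0 1 2 [::] [:: 1] 1
    [:: 1] 3 0 3 [:: true] [:: false].

Lemma single4 : is_quotient_of (hyperoctahedral 4) (triangle_group 2 4 6).
Proof. compute_single block4 4 6 cert4. Qed.

Definition block7 : block := Eval vm_compute in
  mk_block 7
    [:: [:: 1; 2]; [:: 3; 4]; [:: 5; 6]]
    [:: [:: 0; 1]; [:: 2; 3; 4; 5]]
    [:: 0] [:: 1].

Definition cert7 : certificate :=
  Certificate 6 0 5 [:: true] [:: 1; 1; 2; 3] 1
    [:: 2] 6 1 0 [:: false; true] [:: false].

Lemma single7 : is_quotient_of (hyperoctahedral 7) (triangle_group 2 4 6).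
Proof. compute_single block7 4 6 cert7. Qed.

Definition block9 : block := Eval vm_compute in
  mk_block 9
    [:: [:: 1; 2]; [:: 3; 4]; [:: 5; 7]]
    [:: [:: 0; 1; 3; 5]; [:: 4; 6; 7; 8]]
    [:: 6] [:: 2].

Definition cert9 : certificate :=
  Certificate 4 6 3 [::] [:: 1; 3] 4
    [:: 1; 3; 2; 2; 2] 2 3 0 [:: false; true] [:: false].

Lemma single9 : is_quotient_of (hyperoctahedral 9) (triangle_group 2 4 6).
Proof. compute_single block9 4 6 cert9. Qed.

Definition block10 : block := Eval vm_compute in
  mk_block 10
    [:: [:: 1; 2]; [:: 3; 4]; [:: 5; 6]; [:: 8; 9]]
    [:: [:: 0; 1; 2; 3]; [:: 4; 5; 7; 9]; [:: 6; 8]]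
    [:: 7] [::].

Definition cert10 : certificate :=
  Certificate 7 9 2 [:: false] [:: 1; 2] 4
    [:: 1; 2; 3] 3 1 0 [:: true] [:: false].

Lemma single10 : is_quotient_of (hyperoctahedral 10) (triangle_group 2 4 6).
Proof. compute_single block10 4 6 cert10. Qed.

Definition block11 : block := Eval vm_compute in
  mk_block 11
    [:: [:: 1; 2]; [:: 3; 5]; [:: 4; 7]; [:: 6; 9]; [:: 8; 10]]
    [:: [:: 0; 1; 3; 6]; [:: 2; 4; 8; 7]; [:: 5; 9]]
    [:: 4; 7] [:: 5].

Definition cert11 : certificate :=
  Certificate 0 2 1 [:: true; true] [:: 1; 2; 2] 4
    [:: 2] 6 1 0 [:: false] [:: true].

Lemma single11 : is_quotient_of (hyperoctahedral 11) (triangle_group 2 4 6).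
Proof. compute_single block11 4 6 cert11. Qed.

Definition block12 : block := Eval vm_compute in
  mk_block 12
    [:: [:: 1; 2]; [:: 4; 5]; [:: 6; 7]; [:: 8; 10]; [:: 9; 11]]
    [:: [:: 0; 1; 3; 5]; [:: 2; 4; 6; 8]; [:: 7; 9; 11; 10]]
    [:: 0] [::].

Definition cert12 : certificate :=
  Certificate 9 1 11 [:: true; true; false; true; true] [:: 1; 2; 2; 2; 1; 3] 2
    [:: 2] 10 0 1 [:: true] [:: false].

Lemma single12 : is_quotient_of (hyperoctahedral 12) (triangle_group 2 4 6).
Proof. compute_single block12 4 6 cert12. Qed.

Definition block13 : block := Eval vm_compute in
  mk_block 13
    [:: [:: 2; 3]; [:: 4; 6]; [:: 5; 7]; [:: 8; 9]; [:: 10; 11]]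
    [:: [:: 0; 1; 2; 4]; [:: 3; 5; 6; 8]; [:: 9; 10; 11; 12]]
    [:: 12] [:: 10; 11].

Definition cert13 : certificate :=
  Certificate 1 2 3 [::] [:: 1; 2; 3] 4
    [:: 1; 2; 2] 6 2 0 [:: true] [:: false].

Lemma single13 : is_quotient_of (hyperoctahedral 13) (triangle_group 2 4 6).
Proof. compute_single block13 4 6 cert13. Qed.

Definition block14 : block := Eval vm_compute in
  mk_block 14
    [:: [:: 1; 2]; [:: 3; 5]; [:: 4; 7]; [:: 6; 9]; [:: 8; 11]; [:: 10; 13]]
    [:: [:: 0; 1; 3; 6]; [:: 2; 4; 8; 5]; [:: 7; 10; 9; 12]]
    [:: 12] [:: 11].

Definition cert14 : certificate :=
  Certificate 13 10 12 [::] [:: 2] 11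
    [:: 1; 1; 2; 2; 1; 2] 4 2 0 [:: false; true] [:: false].

Lemma single14 : is_quotient_of (hyperoctahedral 14) (triangle_group 2 4 6).
Proof. compute_single block14 4 6 cert14. Qed.

Definition block15 : block := Eval vm_compute in
  mk_block 15
    [:: [:: 1; 2]; [:: 3; 4]; [:: 5; 7]; [:: 6; 8]; [:: 9; 10]; [:: 11; 13]; [:: 12; 14]]
    [:: [:: 0; 1; 3; 5]; [:: 4; 6]; [:: 7; 9; 11; 8]; [:: 10; 12; 14; 13]]
    [::] [:: 6; 12; 14].

Definition cert15 : certificate :=
  Certificate 0 1 7 [:: true; false; true; false] [:: 1; 2; 2; 3] 5
    [:: 1; 2] 5 1 0 [:: false] [:: true].

Lemma single15 : is_quotient_of (hyperoctahedral 15) (triangle_group 2 4 6).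
Proof. compute_single block15 4 6 cert15. Qed.

Definition block16 : block := Eval vm_compute in
  mk_block 16
    [:: [:: 2; 3]; [:: 4; 6]; [:: 5; 7]; [:: 8; 10]; [:: 9; 12]; [:: 11; 14]; [:: 13; 15]]
    [:: [:: 0; 1; 2; 4]; [:: 3; 5; 7; 9]; [:: 6; 8; 11; 12]; [:: 10; 13]; [:: 14; 15]]
    [::] [:: 14].

Definition cert16 : certificate :=
  Certificate 5 7 0 [:: false; true] [:: 1; 1; 3; 2; 2] 8
    [:: 1; 1; 2; 3; 2] 5 1 0 [:: false] [:: true].

Lemma single16 : is_quotient_of (hyperoctahedral 16) (triangle_group 2 4 6).
Proof. compute_single block16 4 6 cert16. Qed.

Definition block17 : block := Eval vm_compute in
  mk_block 17
    [:: [:: 2; 3]; [:: 4; 6]; [:: 5; 7]; [:: 8; 11]; [:: 9; 12]; [:: 10; 13]; [:: 15; 16]]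
    [:: [:: 0; 1; 2; 4]; [:: 3; 5; 8; 12]; [:: 6; 9; 11; 13]; [:: 7; 10; 14; 15]]
    [:: 14] [:: 16].

Definition cert17 : certificate :=
  Certificate 14 8 15 [:: true; false; true; false] [:: 1; 2; 2; 2; 3] 2
    [:: 1; 1; 2; 3; 2; 2] 4 3 0 [:: false; true] [:: false].

Lemma single17 : is_quotient_of (hyperoctahedral 17) (triangle_group 2 4 6).
Proof. compute_single block17 4 6 cert17. Qed.

Definition block18 : block := Eval vm_compute in
  mk_block 18
    [:: [:: 3; 4]; [:: 5; 6]; [:: 7; 8]; [:: 9; 10]; [:: 11; 13]; [:: 14; 15]; [:: 16; 17]]
    [:: [:: 0; 1; 2; 3]; [:: 4; 5; 7; 6]; [:: 8; 9; 11; 14]; [:: 10; 12; 15; 16]]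
    [:: 12] [:: 12; 15; 17].

Definition cert18 : certificate :=
  Certificate 17 16 12 [::] [:: 2] 14
    [:: 1; 2] 12 2 0 [:: false; true] [:: false].

Lemma single18 : is_quotient_of (hyperoctahedral 18) (triangle_group 2 4 6).
Proof. compute_single block18 4 6 cert18. Qed.

Definition block20 : block := Eval vm_compute in
  mk_block 20
    [:: [:: 3; 4]; [:: 5; 6]; [:: 7; 8]; [:: 9; 10]; [:: 12; 14]; [:: 13; 16]; [:: 15; 17]; [:: 18; 19]]
    [:: [:: 0; 1; 2; 3]; [:: 4; 5; 7; 6]; [:: 8; 9; 11; 13]; [:: 10; 12; 15; 17]; [:: 14; 16; 18; 19]]
    [:: 11] [:: 18; 19].

Definition cert20 : certificate :=
  Certificate 18 19 4 [:: true; false; true; true; false; true] [:: 1; 2; 1; 2; 2] 5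
    [:: 1; 3] 9 2 0 [:: true] [:: false].

Lemma single20 : is_quotient_of (hyperoctahedral 20) (triangle_group 2 4 6).
Proof. compute_single block20 4 6 cert20. Qed.

Definition block5 : block := Eval vm_compute in
  mk_block 5
    [:: [:: 3; 4]]
    [:: [:: 0; 1; 2; 3]]
    [:: 2] [::].

Definition cert5 : certificate :=
  Certificate 4 3 1 [::] [:: 2] 2
    [:: 1; 2; 2] 2 0 1 [:: true] [:: false].

Lemma single5 : is_quotient_of (hyperoctahedral 5) (triangle_group 2 4 10).
Proof. compute_single block5 4 10 cert5. Qed.

Definition block6 : block := Eval vm_compute in
  mk_block 6
    [:: [:: 2; 3]; [:: 4; 5]]
    [:: [:: 0; 1; 2; 4; 5; 3]]
    [:: 1] [::].

Definition cert6 : certificate :=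
  Certificate 0 2 1 [::] [:: 1] 2
    [:: 2] 4 0 3 [:: true] [:: false].

Lemma single6 : is_quotient_of (hyperoctahedral 6) (triangle_group 2 6 6).
Proof. compute_single block6 6 6 cert6. Qed.

Definition block8 : block := Eval vm_compute in
  mk_block 8
    [:: [:: 2; 3]; [:: 4; 5]; [:: 6; 7]]
    [:: [:: 0; 1; 2; 4]; [:: 5; 6]]
    [:: 1] [:: 6].

Definition cert8 : certificate :=
  Certificate 7 6 4 [::] [:: 1; 2; 2; 3; 2; 2] 1
    [:: 2] 6 6 0 [:: false; true] [:: false].

Lemma single8 : is_quotient_of (hyperoctahedral 8) (triangle_group 2 4 8).
Proof. compute_single block8 4 8 cert8. Qed.

Theorem theorem1 :
  (forall n : nat, 3 <= n -> n <> 5 -> n <> 6 -> n <> 8 ->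
     is_quotient_of (hyperoctahedral n) (triangle_group 2 4 6)) /\
  is_quotient_of (hyperoctahedral 5) (triangle_group 2 4 10) /\
  is_quotient_of (hyperoctahedral 6) (triangle_group 2 6 6) /\
  is_quotient_of (hyperoctahedral 8) (triangle_group 2 4 8).
Proof.
split; last by split; [exact: single5 | split; [exact: single6 | exact: single8]].
move=> n n3 n5 n6 n8.
have [|n_big] := boolP (n \in [:: 3; 4; 7; 9; 10; 11; 12; 13; 14; 15; 16; 17; 18; 20]).
  rewrite !inE; repeat case/orP; move/eqP->;
  first [ exact: single3 | exact: single4 | exact: single7 | exact: single9
        | exact: single10 | exact: single11 | exact: single12 | exact: single13
        | exact: single14 | exact: single15 | exact: single16 | exact: single17
        | exact: single18 | exact: single20 ].
have [m] : exists m, n \in [:: 18 + 6 * m + 6; 16 + 6 * m + 3; 20 + 6 * m + 6;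
                              18 + 6 * m + 3; 16 + 6 * m + 6; 20 + 6 * m + 3].
  move: n_big; rewrite !inE => n_big.
  (* 20 is treated above, so the residue of 20 starts at 26 *)
  exists (if (n - 19) %% 6 == 1 then (n - 26) %/ 6 else (n - 19) %/ 6).
  by case: eqP => n_mod; rewrite !inE; lia.
rewrite !inE; repeat case/orP; move/eqP->;
first [ exact: chain0 | exact: chain1 | exact: chain2
      | exact: chain3 | exact: chain4 | exact: chain5 ].
Qed.
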